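(* Let $H$ be a cumulative distribution function with support on $\mathbb{R}_+=(0,\infty)$ and let $$f_0(x)=\int_0^\infty \frac{\lambda^{1/2}}{\sqrt{2\pi}}\exp\left\{-\frac{\lambda x^2}{2}\right\}dH(\lambda),\qquad x\in\mathbb{R},$$ be the corresponding scale mixture of normals density. Suppose that $\int_{-\infty}^{\infty}t^2 f_0(t)\,dt<\infty$. Let $\mathbf{x}=(x_1,\dots,x_n)^\top$ be an i.i.d. sample from the location-scale model with density $f(x\mid\mu,\sigma)=\frac{1}{\sigma}f_0\left(\frac{x-\mu}{\sigma}\right)$, with $\mu\in\mathbb{R}$ and $\sigma\in\mathbb{R}_+$. If $n>2$ and $$\int_0^\infty \lambda^{1/2}\,dH(\lambda)<\infty,$$ then, for almost every sample $\mathbf{x}$, the posterior distribution of $(\mu,\sigma)$ associated to the Wasserstein prior $\pi_W(\mu,\sigma)\propto 1$ is proper.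
   Context: The Wasserstein prior of the location-scale model is the (improper) flat prior $\pi_W(\mu,\sigma)\propto 1$ on $\mathbb{R}\times(0,\infty)$. The posterior distribution is called proper if the marginal likelihood (normalising constant) $$m(\mathbf{x})=\int_0^\infty\int_{-\infty}^{\infty}\prod_{i=1}^n\frac{1}{\sigma}f_0\left(\frac{x_i-\mu}{\sigma}\right)d\mu\,d\sigma$$ is finite. ''Almost every sample'' is with respect to the (absolutely continuous) sampling distribution, equivalently Lebesgue measure on $\mathbb{R}^n$. *)

(* Defs.v *)
(* MathComp-Analysis *)
From HB Require Import structures.
From mathcomp Require Export all_boot all_order all_algebra.
From mathcomp Require Export all_classical all_reals all_analysis.

Set Implicit Arguments.
Unset Strict Implicit.
Unset Printing Implicit Defensive.
Import Order.TTheory GRing.Theory Num.Theory.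
Import numFieldNormedType.Exports.

Local Open Scope classical_set_scope.
Local Open Scope ring_scope.
Local Open Scope ereal_scope.

Definition supported_on_pos (R : realType) (H : cumulativeBounded (0 : R) (1 : R)) : Prop :=
  lebesgue_stieltjes_measure H `]0%R, +oo[ = 1.

(* Extended-real valued: for a general H the integral may diverge at x = 0. *)
Definition normal_scale_mixture (R : realType)
    (H : cumulativeBounded (0 : R) (1 : R)) (x : R) : \bar R :=
  \int[lebesgue_stieltjes_measure H]_(l in `]0%R, +oo[)
    (Num.sqrt l / Num.sqrt (2 * pi) * expR (- (l * x ^+ 2 / 2)))%:E.

Definition location_scale (R : realType) (f0 : R -> \bar R) (mu sigma x : R) :
    \bar R :=
  (sigma^-1)%:E * f0 ((x - mu) / sigma)%R.

(* For a finite family, the product rule over all choices of events B i,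
   including B i = setT, is mutual independence. *)
Definition mutually_independent d (T : measurableType d) (R : realType)
    (P : probability T R) (n : nat) (X : 'I_n -> {RV P >-> R}) : Prop :=
  forall B : 'I_n -> set R, (forall i, measurable (B i)) ->
    P (\bigcap_i (X i @^-1` B i)) = \prod_(i < n) P (X i @^-1` B i).

Definition has_density d (T : measurableType d) (R : realType)
    (P : probability T R) (X : {RV P >-> R}) (f : R -> \bar R) : Prop :=
  forall B : set R, measurable B ->
    distribution P X B = \int[lebesgue_measure]_(t in B) f t.

Definition iid_sample d (T : measurableType d) (R : realType)
    (P : probability T R) (n : nat) (X : 'I_n -> {RV P >-> R})
    (f : R -> \bar R) : Prop :=
  mutually_independent X /\ forall i, has_density (X i) f.

(* Density, with respect to Lebesgue measure on R x ]0, +oo[, of the improper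
   Wasserstein prior of a location-scale model. *)
Definition wasserstein_prior (R : realType) (mu sigma : R) : \bar R := 1.

Definition marginal_likelihood (R : realType) (f : R -> R -> R -> \bar R)
    (prior : R -> R -> \bar R) (n : nat) (x : 'I_n -> R) : \bar R :=
  \int[lebesgue_measure]_(sigma in `]0%R, +oo[)
    \int[lebesgue_measure]_mu
      (prior mu sigma * \prod_(i < n) f mu sigma (x i)).

Definition posterior_proper (R : realType) (f : R -> R -> R -> \bar R)
    (prior : R -> R -> \bar R) (n : nat) (x : 'I_n -> R) : Prop :=
  marginal_likelihood f prior x < +oo.

(* Main.v *)
(* Integrability of [sqrt] under [H] bounds [f0] by a constant [c], and
   [u exp(- u^2 / 2) <= 1] gives [f0 t <= 1 / |t|]. Almost surely the sample
   points are distinct, so for every [mu] all the factors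
   [sigma^-1 f0 ((x_i - mu) / sigma)] but one are at most some [D] which does
   not depend on [mu] and [sigma]; they are also all at most [c / sigma].
   Keeping the remaining factor, which has integral at most 1 in [mu], the inner
   integral is O(1) for [sigma < 1] and O(sigma^(1 - n)) for [sigma >= 1], hence
   O(1 / (1 + sigma^2)) as [n > 2]. *)
Require Import Defs.
From mathcomp Require Import ring lra measurable_realfun.

Set Implicit Arguments.
Unset Strict Implicit.
Unset Printing Implicit Defensive.
Import Order.TTheory GRing.Theory Num.Theory.
Import numFieldNormedType.Exports.

Local Open Scope classical_set_scope.
Local Open Scope ring_scope.

(** * Deterministic bound on the product of likelihood factors *)

Lemma prod_le_expr (R : realType) (n : nat) (a : 'I_n -> R) (M : R) (j : 'I_n) :
  (forall i, 0 <= a i) -> (forall i, i != j -> a i <= M) ->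
  \prod_(i < n) a i <= a j * M ^+ n.-1.
Proof.
move=> a0 aM; rewrite (bigD1 j)//= ler_wpM2l//.
apply: le_trans (_ : \prod_(i < n | i != j) M <= _).
  by apply: ler_prod => i ij; rewrite a0 aM.
by rewrite prodr_const cardC1 card_ord.
Qed.

(* Two points at distance at least [4 / D] cannot both be within [1 / D] of
   [mu], and away from [mu] the bound [`|x i - mu| * a i <= 1] gives
   [a i <= D]. *)
Lemma all_but_one_le (R : realType) (n : nat) (x a : 'I_n -> R) (D mu : R) :
  (0 < n)%N -> 0 <= D ->
  (forall i j, i != j -> 4 <= D * `|x i - x j|) ->
  (forall i, `|x i - mu| * a i <= 1) ->
  exists j, forall i, i != j -> a i <= D.
Proof.
move=> n0 D0 xD xa.
have [[j aj]|/forallNP aD] := pselect (exists j, D < a j); last first.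
  exists (Ordinal n0) => i _; rewrite leNgt; exact/negP/aD.
exists j => i ij; rewrite leNgt; apply/negP => ai.
have near k : D < a k -> D * `|x k - mu| <= 1.
  by move=> Dk; rewrite mulrC (le_trans _ (xa k))// ler_wpM2l// ltW.
have := xD _ _ ij; have := near _ ai; have := near _ aj.
have : D * `|x i - x j| <= D * (`|x i - mu| + `|x j - mu|).
  by rewrite ler_wpM2l// (distrC (x j)) ler_distD.
rewrite mulrDr; lra.
Qed.

Lemma separation_constant (R : realType) (n : nat) (x : 'I_n -> R) :
  injective x ->
  exists2 D, 0 <= D & forall i j, i != j -> 4 <= D * `|x i - x j|.
Proof.
move=> injx.
(* The sum over all pairs dominates each of its terms; the diagonal terms are [4 / 0 = 0]. *)
pose D := \sum_(i < n) \sum_(j < n) 4 / `|x i - x j|.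
exists D; first by do 2!apply: sumr_ge0 => ? _; rewrite divr_ge0.
move=> i j ij.
have xij : 0 < `|x i - x j|.
  by rewrite normr_gt0 subr_eq0; apply: contra_neq ij => /injx.
rewrite -ler_pdivrMr// /D (bigD1 i)//= (bigD1 j)//= -addrA lerDl addr_ge0//.
- by apply: sumr_ge0 => k _; rewrite divr_ge0.
- by do 2!apply: sumr_ge0 => ? _; rewrite divr_ge0.
Qed.

(** The factor left unbounded has an index that varies with [mu] and [s]. Replacing it by the sum of
    all factors gives a bound that can be integrated term by term in [mu]. *)
Lemma prod_location_scale_le (R : realType) (n : nat) (g : R -> R) (c : R)
    (x : 'I_n -> R) :
  (2 < n)%N -> (forall t, 0 <= g t <= c) -> (forall t, `|t| * g t <= 1) ->
  injective x ->
  exists2 K, 0 <= K & forall mu s : R, 0 < s ->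
    \prod_(i < n) (s^-1 * g ((x i - mu) / s)) <=
    K * (oneDsqr s)^-1 * \sum_(i < n) (s^-1 * g ((x i - mu) / s)).
Proof.
move=> n2 gc tg injx; have n0 : (0 < n)%N by exact: leq_trans n2.
have c0 : 0 <= c by have /andP[g0 /(le_trans g0)] := gc 0.
have [D D0 xD] := separation_constant injx.
have cn0 : 0 <= c ^+ n.-1 by exact: exprn_ge0.
have Dn0 : 0 <= D ^+ n.-1 by exact: exprn_ge0.
(* The power of [D] serves [s < 1] and the power of [c] serves [1 <= s]. The factor [2] comes from
   [1 + s ^+ 2], which is at most [2] in the first case and at most [2 * s ^+ n.-1] in the
   second. *)
exists (2 * (c ^+ n.-1 + D ^+ n.-1)); first by rewrite mulr_ge0// addr_ge0.
move=> mu s s0; pose a i := s^-1 * g ((x i - mu) / s).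
have s1 : 0 < oneDsqr s by rewrite /oneDsqr ltr_pwDl// sqr_ge0.
have a0 i : 0 <= a i.
  by rewrite mulr_ge0 ?invr_ge0 ?(ltW s0)//; case/andP: (gc ((x i - mu) / s)).
(* At [t = (x i - mu) / s] the bound on [|t| * g t] is free of the scale, so the same [D] works for
   every [s]. *)
have xa i : `|x i - mu| * a i <= 1.
  by rewrite mulrA; have := tg ((x i - mu) / s); rewrite normrM normfV (gtr0_norm s0).
suff [j [M [M0 aM MK]]] : exists j M, [/\ 0 <= M, forall i, i != j -> a i <= M &
    M ^+ n.-1 <= 2 * (c ^+ n.-1 + D ^+ n.-1) * (oneDsqr s)^-1].
  apply: le_trans (prod_le_expr a0 aM) _; rewrite mulrC.
  apply: ler_pM => //; first exact: exprn_ge0.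
  by rewrite (bigD1 j)//= lerDl; apply: sumr_ge0 => i _; exact: a0.
have [s_lt1|s_ge1] := ltP s 1.
  have [j aD] := all_but_one_le n0 D0 xD xa.
  exists j, D; split=> //; rewrite ler_pdivlMr//.
  have : oneDsqr s <= 2 by rewrite /oneDsqr; nra.
  by nra.
(* All factors are at most [c / s], so any index may be the exceptional one. *)
exists (Ordinal n0), (c / s); split=> [|i _|]; first by rewrite divr_ge0// ltW.
  by rewrite /a mulrC ler_wpM2r ?invr_ge0 ?(ltW s0)//; case/andP: (gc ((x i - mu) / s)).
rewrite ler_pdivlMr// expr_div_n mulrAC ler_pdivrMr ?exprn_gt0//.
have : oneDsqr s <= 2 * s ^+ n.-1.
  (* Since [2 < n], the exponent [n.-1] is at least [2]. *)
  have : s ^+ 2 <= s ^+ n.-1 by rewrite ler_weXn2l// -ltnS prednK.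
  by rewrite /oneDsqr; nra.
have : 0 < s ^+ n.-1 by rewrite exprn_gt0.
by nra.
Qed.

(** * Integral monotonicity and almost sure distinctness of the sample points *)

Local Open Scope ereal_scope.

(* The integral of a nonnegative function is a supremum over the simple
   functions below it, so monotonicity does not require measurability. *)
Lemma ge0_le_integral_nonmeasurable d (T : measurableType d) (R : realType)
    (mu : {measure set T -> \bar R}) (D : set T) (f g : T -> \bar R) :
  (forall t, D t -> 0 <= f t) -> (forall t, D t -> f t <= g t) ->
  \int[mu]_(t in D) f t <= \int[mu]_(t in D) g t.
Proof.
move=> f0 fg; have g0 t : D t -> 0 <= g t.
  by move=> Dt; exact: le_trans (f0 _ Dt) (fg _ Dt).
rewrite !ge0_integralE//; apply: ereal_sup_le => _ [h hf <-].
by exists h => // t; apply: le_trans (hf t) _; exact: lee_restrict.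
Qed.

Lemma measurable_eq_points d (T : measurableType d) (R : realType)
    (f g : T -> R) :
  measurable_fun setT f -> measurable_fun setT g ->
  measurable [set t | f t = g t].
Proof.
move=> mf mg; rewrite (_ : [set _ | _] = (f \- g)%R @^-1` [set 0%R]).
  rewrite -[X in measurable X]setTI.
  have mfg : measurable_fun setT (f \- g)%R by exact: measurable_funB.
  exact: mfg.
apply/seteqP; split=> t /=; first by move=> ->; rewrite subrr.
by move/eqP; rewrite subr_eq0 => /eqP.
Qed.

Section distinct.
Context d (T : measurableType d) (R : realType) (P : probability T R).

Lemma mutually_independent_pair (n : nat) (X : 'I_n -> {RV P >-> R})
    (i j : 'I_n) (A B : set R) :
  mutually_independent X -> i != j -> measurable A -> measurable B ->
  P (X i @^-1` A `&` X j @^-1` B) = P (X i @^-1` A) * P (X j @^-1` B).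
Proof.
move=> indX ij mA mB.
(* The product rule is applied with [setT] at all other indices, each contributing a factor [1]. *)
pose C k := if k == i then A else if k == j then B else setT.
have /indX : forall k, measurable (C k).
  by move=> k; rewrite /C; case: ifP => // _; case: ifP.
rewrite (bigD1 i)//= (bigD1 j) 1?eq_sym//= big1 => [|k /andP[ki kj]]; last first.
  by rewrite /C (negbTE ki) (negbTE kj) preimage_setT probability_setT.
rewrite mule1 /C eqxx eq_sym (negbTE ij) eqxx => <-; congr (P _).
apply/seteqP; split=> [w [Aw Bw] k _|w Cw].
  by case: ifP => [/eqP->//|_]; case: ifP => [/eqP->|].
split; first by have := Cw i Logic.I; rewrite /= eqxx.
by have := Cw j Logic.I; rewrite /= eq_sym (negbTE ij) eqxx.
Qed.

(** By independence the joint law is the product of the marginals. Each section of the diagonal is a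
    singleton, null for the law of [Y], so the diagonal is null by integration over sections. *)
Lemma independent_atomless_neq (X Y : {RV P >-> R}) :
  (forall A B, measurable A -> measurable B ->
    P (X @^-1` A `&` Y @^-1` B) = P (X @^-1` A) * P (Y @^-1` B)) ->
  (forall a, distribution P Y [set a] = 0) ->
  P [set w | X w = Y w] = 0.
Proof.
move=> indXY atomless.
pose XY w := (X w, Y w).
have mXY : measurable_fun setT XY by exact/measurable_fun_pair.
pose diag := [set p : R * R | p.1 = p.2].
have mdiag : measurable diag. by exact: measurable_eq_points.
have XYE A B : measurable A -> measurable B ->
    distribution P (mfun_Sub (mem_set mXY)) (A `*` B) =
    distribution P X A * distribution P Y B.
  by move=> mA mB; rewrite -indXY.
rewrite -[LHS]/(distribution P (mfun_Sub (mem_set mXY)) diag).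
rewrite -(product_measure_unique XYE mdiag).
rewrite [LHS]integral0_eq// => x _ /=.
rewrite -[RHS](atomless x); congr (distribution P Y _).
by apply/seteqP; split=> y /=; rewrite /xsection/= inE.
Qed.

(** A law with a density has no atoms, so each pair of distinct indices gives a null coincidence
    event, and there are finitely many pairs. *)
Lemma iid_sample_injective (n : nat) (X : 'I_n -> {RV P >-> R}) (f : R -> \bar R) :
  iid_sample X f -> {ae P, forall w, injective (fun i => X i w)}.
Proof.
move=> [indX fX].
have : {ae P, forall w, forall i j, X i w = X j w -> i = j}.
  apply: filter_forall => i; apply: filter_forall => j.
  have [<-|ij] := eqVneq i j; first by apply: aeW.
  exists [set w | X i w = X j w]; split.
  - exact: measurable_eq_points.
  - apply: independent_atomless_neq => [A B mA mB|a].
      exact: mutually_independent_pair.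
    by rewrite (fX j)// integral_set1.
  - by move=> w /=; apply: contra_notP => XX /XX.
by [].
Qed.
End distinct.

(** * Pointwise bounds and measurability of the normal kernel *)

(** For [0 < l], the centred normal density at [x] with precision [l]. *)
Definition normal_kernel (R : realType) (x l : R) : R :=
  Num.sqrt l / Num.sqrt (2 * pi) * expR (- (l * x ^+ 2 / 2)).

Section normal_kernel.
Local Open Scope ring_scope.
Variable R : realType.
Implicit Types x l s m : R.

Lemma normal_kernel_ge0 x l : 0 <= normal_kernel x l.
Proof. by rewrite mulr_ge0 ?expR_ge0// divr_ge0// sqrtr_ge0. Qed.

Lemma normal_kernel_nonpos x l : l <= 0 -> normal_kernel x l = 0.
Proof. by move=> l0; rewrite /normal_kernel ler0_sqrtr// !mul0r. Qed.

Lemma sqrt_2pi_ge1 : 1 <= Num.sqrt (2 * pi) :> R.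
Proof.
by rewrite -[leLHS]sqrtr1 ler_wsqrtr//; have := pi_ge2 R; lra.
Qed.

Lemma normal_kernel_le_expR x l :
  normal_kernel x l <= Num.sqrt l * expR (- (l * x ^+ 2 / 2)).
Proof.
rewrite ler_wpM2r ?expR_ge0// ler_pdivrMr ?(lt_le_trans ltr01 sqrt_2pi_ge1)//.
by rewrite ler_peMr ?sqrtr_ge0// sqrt_2pi_ge1.
Qed.

Lemma normal_kernel_le_sqrt x l : 0 <= l -> normal_kernel x l <= Num.sqrt l.
Proof.
move=> l0; apply: le_trans (normal_kernel_le_expR x l) _.
rewrite ler_piMr ?sqrtr_ge0// expR_le1 oppr_le0.
by rewrite divr_ge0// mulr_ge0// sqr_ge0.
Qed.

(* With [u = `|x| * sqrt l] this is [u <= 1 + u ^+ 2 / 2 <= expR (u ^+ 2 / 2)]. *)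
Lemma norm_normal_kernel_le1 x l : 0 <= l -> `|x| * normal_kernel x l <= 1.
Proof.
move=> l0; apply: le_trans (ler_wpM2l _ (normal_kernel_le_expR x l)) _ => //.
rewrite mulrA expRN ler_pdivrMr ?expR_gt0// mul1r.
apply: le_trans (expR_ge1Dx _).
rewrite -[x ^+ 2]real_normK ?num_real// -{2}(sqr_sqrtr l0) -exprMn mulrC.
set u := _ * _; nra.
Qed.

Lemma measurable_sqrt : measurable_fun setT (@Num.sqrt R).
Proof. exact: (continuous_measurable_fun (@sqrt_continuous R)). Qed.

Lemma measurable_normal_kernel :
  measurable_fun setT (fun p : R * R => normal_kernel p.1 p.2).
Proof.
apply: measurable_funM; first apply: measurable_funM => //.
  exact: measurableT_comp measurable_sqrt measurable_snd.
apply: measurableT_comp => //; apply: measurableT_comp => //.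
apply: measurable_funM => //; apply: measurable_funM => //.
exact: measurable_funX.
Qed.

(** By symmetry the location [m] and the observation [x] exchange roles: as a function of [m] this
    is a normal density with mean [x], hence of total mass [1]. *)
Lemma normal_kernel_pdf x l s m : 0 < l -> 0 < s ->
  s^-1 * normal_kernel ((x - m) / s) l = normal_pdf x (s / Num.sqrt l) m.
Proof.
move=> l0 s0; have sl0 : 0 < Num.sqrt l by rewrite sqrtr_gt0.
rewrite normal_pdfE ?gt_eqF ?divr_gt0// /normal_peak /normal_fun /normal_kernel.
rewrite -mulrnAr (sqrtrM (pi *+ 2)) ?sqr_ge0// sqrtr_sqr gtr0_norm ?divr_gt0//.
rewrite mulrA; congr (_ * expR _).
  rewrite invfM invf_div mulrA (mulrC _^-1); congr (_ / Num.sqrt _).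
  by rewrite mulr_natl.
rewrite !expr_div_n sqr_sqrtr ?(ltW l0)//.
by field; rewrite !gt_eqF.
Qed.

End normal_kernel.

(** * Bounds on the scale mixture and its integral over the location *)

Section scale_mixture.
Variables (R : realType) (H : cumulativeBounded (0 : R) (1 : R)).
Let nu := lebesgue_stieltjes_measure H.

(* [Num.sqrt] vanishes on nonpositive reals, hence so does the kernel. *)
Lemma normal_scale_mixtureE x :
  normal_scale_mixture H x = \int[nu]_l (normal_kernel x l)%:E.
Proof.
rewrite /normal_scale_mixture integral_mkcond; apply: eq_integral => l _.
rewrite patchE; case: ifPn => // lD; rewrite normal_kernel_nonpos//.
by rewrite leNgt; apply: contra lD => l0; rewrite inE/= in_itv/= l0.
Qed.

Lemma normal_scale_mixture_ge0 x : 0 <= normal_scale_mixture H x.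
Proof. by apply: integral_ge0 => l _; rewrite lee_fin normal_kernel_ge0. Qed.

Lemma measurable_normal_kernel_l x :
  measurable_fun setT (fun l : R => (normal_kernel x l)%:E).
Proof.
apply/measurable_EFinP.
exact: measurableT_comp (@measurable_normal_kernel R) (measurable_pair1 x).
Qed.

Lemma normal_scale_mixture_le_sqrt_moment x :
  normal_scale_mixture H x <= \int[nu]_(l in `]0%R, +oo[) (Num.sqrt l)%:E.
Proof.
apply: ge0_le_integral_nonmeasurable => l; rewrite /= in_itv/= andbT => l0.
  by rewrite lee_fin normal_kernel_ge0.
by rewrite lee_fin normal_kernel_le_sqrt// ltW.
Qed.

(** The pointwise bound on the kernel is averaged over the probability [nu]. *)
Lemma norm_normal_scale_mixture_le1 x :
  `|x|%:E * normal_scale_mixture H x <= 1.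
Proof.
rewrite normal_scale_mixtureE -ge0_integralZl//; last 2 first.
- exact: measurable_normal_kernel_l.
- by move=> l _; rewrite lee_fin normal_kernel_ge0.
rewrite -[leRHS](probability_setT nu) -[leRHS]mul1e -integral_cst//.
apply: ge0_le_integral_nonmeasurable => l _.
  by rewrite mule_ge0// lee_fin normal_kernel_ge0.
rewrite -EFinM lee_fin; have [l0|/ltW l0] := leP 0%R l.
  exact: norm_normal_kernel_le1.
by rewrite normal_kernel_nonpos// mulr0.
Qed.

Lemma measurable_normal_scale_mixture :
  measurable_fun setT (normal_scale_mixture H).
Proof.
rewrite (_ : normal_scale_mixture H =
    fubini_F nu (fun p => (normal_kernel p.1 p.2)%:E)); last first.
  by apply/funext => x; rewrite normal_scale_mixtureE.
apply: measurable_fun_fubini_tonelli_F => [|p].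
  by apply/measurable_EFinP; exact: measurable_normal_kernel.
by rewrite lee_fin normal_kernel_ge0.
Qed.

Lemma location_scale_ge0 m s x : (0 < s)%R ->
  0 <= location_scale (normal_scale_mixture H) m s x.
Proof.
by move=> s0; rewrite mule_ge0 ?normal_scale_mixture_ge0// lee_fin invr_ge0 ltW.
Qed.

Lemma measurable_location_scale s x :
  measurable_fun setT (fun m => location_scale (normal_scale_mixture H) m s x).
Proof.
apply: measurable_funeM.
apply: measurableT_comp; first exact: measurable_normal_scale_mixture.
by apply: measurable_funM => //; exact: measurable_funB.
Qed.

(** By Tonelli the location is integrated first. That integral is [1] for [0 < l] and [0] for
    [l <= 0], so the total is at most the mass of [nu]. *)
Lemma integral_location_scale_le1 s x : (0 < s)%R ->
  \int[lebesgue_measure]_m location_scale (normal_scale_mixture H) m s x <= 1.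
Proof.
move=> s0; pose k (p : R * R) : \bar R := (s^-1 * normal_kernel ((x - p.1) / s) p.2)%:E.
have k0 p : 0 <= k p.
  by rewrite lee_fin mulr_ge0 ?normal_kernel_ge0// invr_ge0 ltW.
have mk : measurable_fun setT k.
  apply/measurable_EFinP; apply: measurable_funM => //.
  have mp : measurable_fun setT (fun p : R * R => ((x - p.1) / s, p.2)%R).
    apply/measurable_fun_pair => //=.
    by apply: measurable_funM => //; exact: measurable_funB.
  exact: measurableT_comp (@measurable_normal_kernel R) mp.
have -> : \int[lebesgue_measure]_m location_scale (normal_scale_mixture H) m s x =
    \int[lebesgue_measure]_m \int[nu]_l k (m, l).
  apply: eq_integral => m _.
  rewrite /location_scale normal_scale_mixtureE -ge0_integralZl//.
  - exact: measurable_normal_kernel_l.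
  - by move=> l _; rewrite lee_fin normal_kernel_ge0.
  - by rewrite lee_fin invr_ge0 ltW.
have -> : \int[lebesgue_measure]_m \int[nu]_l k (m, l) =
    \int[nu]_l \int[lebesgue_measure]_m k (m, l).
  exact: (@fubini_tonelli _ _ _ _ _ lebesgue_measure nu).
rewrite -[leRHS](probability_setT nu) -[leRHS]mul1e -integral_cst//.
apply: ge0_le_integral_nonmeasurable => l _; first exact: integral_ge0.
have [l0|l0] := leP l 0%R.
  rewrite integral0_eq// => m _.
  by rewrite /k/= normal_kernel_nonpos// mulr0.
under eq_integral do rewrite /k/= normal_kernel_pdf//.
by rewrite integral_normal_pdf.
Qed.

End scale_mixture.

(** * Finiteness of the marginal likelihood *)

Lemma posterior_proper_of_injective (R : realType)
    (H : cumulativeBounded (0 : R) (1 : R)) (n : nat) (x : 'I_n -> R) :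
  \int[lebesgue_stieltjes_measure H]_(l in `]0%R, +oo[) (Num.sqrt l)%:E < +oo ->
  (2 < n)%N -> injective x ->
  posterior_proper (location_scale (normal_scale_mixture H))
    (@wasserstein_prior R) x.
Proof.
set S := (X in X < +oo -> _) => Soo n2 injx.
set f0 := normal_scale_mixture H.
have S0 : 0 <= S by apply: integral_ge0 => l _; rewrite lee_fin sqrtr_ge0.
have Sfin : S \is a fin_num by rewrite ge0_fin_numE.
(* Finiteness of [f0] everywhere allows passing to the real-valued [g], to which the deterministic
   product bound applies. *)
have f0fin t : f0 t \is a fin_num.
  rewrite ge0_fin_numE ?normal_scale_mixture_ge0//.
  exact: le_lt_trans (normal_scale_mixture_le_sqrt_moment H t) Soo.
pose g t := fine (f0 t).
have g_bounds t : (0 <= g t <= fine S)%R.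
  by rewrite fine_ge0 ?normal_scale_mixture_ge0//= fine_le//
    normal_scale_mixture_le_sqrt_moment.
have norm_g t : (`|t| * g t <= 1)%R.
  by rewrite -lee_fin EFinM fineK//; exact: norm_normal_scale_mixture_le1.
have locE m s i : location_scale f0 m s (x i) =
    (s^-1 * g ((x i - m) / s))%:E.
  by rewrite /location_scale EFinM fineK.
have [K K0 prodK] := prod_location_scale_le n2 g_bounds norm_g injx.
have inner s : (0 < s)%R ->
    \int[lebesgue_measure]_m
      (wasserstein_prior m s * \prod_(i < n) location_scale f0 m s (x i)) <=
    (K * n%:R)%:E * ((oneDsqr s)^-1)%:E.
  move=> s0.
  have Ks0 : (0 <= K * (oneDsqr s)^-1)%R.
    by rewrite mulr_ge0// invr_ge0 (le_trans ler01 (oneDsqr_ge1 s)).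
  have sum0 m : 0 <= \sum_(i < n) location_scale f0 m s (x i).
    by apply: sume_ge0 => i _; exact: location_scale_ge0.
  apply: (@le_trans _ _ (\int[lebesgue_measure]_m ((K * (oneDsqr s)^-1)%:E *
      \sum_(i < n) location_scale f0 m s (x i)))).
    apply: ge0_le_integral_nonmeasurable => m _; rewrite /wasserstein_prior mul1e.
      by apply: prode_ge0 => i _; exact: location_scale_ge0.
    under eq_bigr do rewrite locE; under [in leRHS]eq_bigr do rewrite locE.
    by rewrite prodEFin sumEFin -EFinM lee_fin prodK.
  have mloc i : measurable_fun setT (fun m => location_scale f0 m s (x i)).
    exact: measurable_location_scale.
  rewrite ge0_integralZl//; last exact: emeasurable_sum.
  (* Each of the [n] summands integrates to at most [1], whence the factor [n%:R]. *)
  rewrite ge0_integral_sum//; last by move=> i m _; exact: location_scale_ge0.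
  rewrite -[leRHS]EFinM mulrAC [leRHS]EFinM; apply: lee_wpmul2l => //.
  apply: (@le_trans _ _ (\sum_(i < n) 1)).
    by apply: lee_sum => i _; exact: integral_location_scale_le1.
  by rewrite sumEFin sumr_const card_ord.
rewrite /posterior_proper /marginal_likelihood.
have oneDsqrV0 s : 0 <= ((oneDsqr s)^-1)%:E :> \bar R.
  by rewrite lee_fin invr_ge0 (le_trans ler01 (oneDsqr_ge1 s)).
have moneDsqrV : measurable_fun setT (fun s : R => ((oneDsqr s)^-1)%:E).
  apply/measurable_EFinP.
  exact: (continuous_measurable_fun (@continuous_oneDsqrV R)).
apply: (@le_lt_trans _ _ (\int[lebesgue_measure]_(s in `]0%R, +oo[)
    ((K * n%:R)%:E * ((oneDsqr s)^-1)%:E))).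
  apply: ge0_le_integral_nonmeasurable => s; rewrite /= in_itv/= andbT => s0.
    apply: integral_ge0 => m _; rewrite /wasserstein_prior mul1e.
    by apply: prode_ge0 => i _; exact: location_scale_ge0.
  exact: inner.
rewrite ge0_integralZl//; last 2 first.
- exact: measurable_funTS.
- by rewrite lee_fin mulr_ge0.
(* [pi / 2] is the integral of [1 / (1 + s ^+ 2)] over the closed half-line, which contains the open
   one. *)
apply: (@le_lt_trans _ _ ((K * n%:R)%:E * (pi / 2)%:E)); last first.
  by rewrite -EFinM ltry.
apply: lee_wpmul2l; first by rewrite lee_fin mulr_ge0.
rewrite -integral0y_oneDsqr; apply: ge0_subset_integral => //.
- exact: measurable_funTS.
- by apply: subset_itvr; rewrite bnd_simp.
Qed.

Theorem theorem2 (R : realType) (H : cumulativeBounded (0 : R) (1 : R))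
    (suppH : supported_on_pos H)
    (moment2 : \int[lebesgue_measure]_t
      ((t ^+ 2)%:E * normal_scale_mixture H t) < +oo)
    (d : measure_display) (T : measurableType d) (P : probability T R)
    (n : nat) (X : 'I_n -> {RV P >-> R}) (mu0 sigma0 : R)
    (sigma0_gt0 : (0 < sigma0)%R)
    (iidX : iid_sample X
      (location_scale (normal_scale_mixture H) mu0 sigma0))
    (n_gt2 : (2 < n)%N)
    (sqrt_moment : \int[lebesgue_stieltjes_measure H]_(l in `]0%R, +oo[)
      (Num.sqrt l)%:E < +oo) :
  {ae P, forall w : T,
    posterior_proper (location_scale (normal_scale_mixture H))
      (@wasserstein_prior R) (fun i : 'I_n => X i w)}.
Proof.
(* Randomness enters only through distinctness: outside the null event of coincidences, the
   deterministic result applies to each sample. *)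
have := iid_sample_injective iidX; apply: filterS => w.
exact: posterior_proper_of_injective.
Qed.
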